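(* Let $N\ge 1$ and let $\mu \vdash N+1$ be a partition of length $p$ with $p \equiv N \pmod 2$. Then $$\frac{N+1}{2} \sum_{\substack{i>0\\ \lambda = \mu^{\downarrow (i+1)}}} i\, m_i(\lambda)\, B(\lambda) \;=\; A(\mu) \;=\; \frac{(N+1)!}{z_\mu},$$ where the sum runs over all $i>0$ such that $\mu$ has at least one part equal to $i+1$.
   Context: For a partition $\lambda \vdash n$, $m_i(\lambda)$ denotes the number of parts of $\lambda$ equal to $i$, and $z_\mu=\prod_i i^{m_i(\mu)} m_i(\mu)!$. The type of a permutation is the partition given by its cycle lengths. $A(\lambda)$ is the number of permutations in $S_n$ of type $\lambda$. For $\lambda \vdash N$, $B(\lambda)$ is the number of permutations $\beta\in S_N$ of type $\lambda$ such that $(1\ 2\ \ldots\ N)\beta^{-1}$ is an $N$-cycle. If $\mu$ has at least one part equal to $i+1$, $\mu^{\downarrow (i+1)}$ is the partition obtained from $\mu$ by removing one part $i+1$ and adding one part $i$ (so it has the same length as $\mu$ and size one less). *)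

(* Defs.v *)
From mathcomp Require Import all_boot all_order all_algebra all_fingroup.
Set Implicit Arguments. Unset Strict Implicit. Unset Printing Implicit Defensive.

Definition is_partition (n : nat) (l : seq nat) : bool :=
  [&& sorted geq l, all (fun x => 0 < x) l & sumn l == n].

Definition mult (i : nat) (l : seq nat) : nat := count_mem i l.

Definition zee (l : seq nat) : nat :=
  \prod_(i <- undup l) (i ^ mult i l * (mult i l)`!).

Definition cycle_type (T : finType) (s : {perm T}) : seq nat :=
  sort geq [seq #|(X : {set T})| | X <- enum (porbits s)].

Definition Acount (n : nat) (l : seq nat) : nat :=
  #|[set s : {perm 'I_n} | cycle_type s == l]|.

Definition longcycle (N : nat) : {perm 'I_N} := perm (@ordS_inj N).

(* B(lambda): beta of type lambda with (1 2 ... N) o beta^{-1} an N-cycle.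
   In mathcomp, (beta^-1 * c) is the function x |-> c (beta^-1 x). *)
Definition Bcount (N : nat) (l : seq nat) : nat :=
  #|[set b : {perm 'I_N} |
     (cycle_type b == l) && (cycle_type (b^-1 * longcycle N)%g == [:: N])]|.

Definition down (i1 : nat) (l : seq nat) : seq nat :=
  sort geq (i1.-1 :: rem i1 l).

(* Main.v *)
(* The heart is a uniformity statement: an odd permutation a of
   m + 2 points is, in exactly 2 m! ways, a product c d^-1 of an (m+2)-cycle c
   and an (m+1)-cycle d.  Inserting a point x into a permutation is
   multiplication by a transposition (x y), and this turns a cycle on S minus x
   into a cycle on S.  Deleting a point x moved by a from such
   factorizations gives recursions whose right-hand sides only involve the odd
   permutations a (x y) (x a(x)) of S minus x; they add up to the same statement
   for m - 1.
   Now count the factorizations of all permutations of type mu of N + 1 points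
   in which d fixes a given point.  By conjugacy there are 2 (N-1)! A(mu) / (N+1)
   of them.  On the other hand, deleting the given point leaves a permutation
   of type down (i+1) mu, factored into two N-cycles, and the point can be
   reinserted in i m_i ways; this gives (N-1)! times the sum of the theorem.
   Deleting a point also yields a recursion for A(mu), solved by
   (N+1)! / z_mu. *)
Require Import Defs.
From mathcomp Require Import all_boot all_order all_algebra all_fingroup.
From mathcomp Require Import zify.
Import GRing.Theory Num.Theory.

(** * Counting factorizations into long cycles *)

Section LongCycles.

Set Implicit Arguments.
Unset Strict Implicit.
Local Open Scope group_scope.

Variable T : finType.
Implicit Types (S : {set T}) (a c d : {perm T}) (x y z w : T).

(* [c] is a single cycle through all of [S] (for nonempty [S]), expressed by
   its number of orbits so that [porbits_mul_tperm] applies. *)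
Definition long S c := perm_on S c && (#|porbits c| + #|S| == #|T|.+1).

Lemma perm_on_tperm S x y : x \in S -> y \in S -> perm_on S (tperm x y).
Proof.
move=> xS yS; apply: subset_trans (tperm_on x y) _.
by apply/subsetP=> z; rewrite !inE => /orP[] /eqP ->.
Qed.

Lemma perm_on_tpermM S x y d :
  x \in S -> y \in S -> perm_on S (tperm x y * d) = perm_on S d.
Proof.
move=> xS yS; have tS := perm_on_tperm xS yS.
apply/idP/idP => [|/(perm_onM tS)//].
by move/(perm_onM tS); rewrite mulgA tperm2 mul1g.
Qed.

Lemma perm_onD1 S x d : perm_on (S :\ x) d = perm_on S d && (d x == x).
Proof.
apply/idP/andP => [dS | [dS /eqP dx]].
  split; first exact: subset_trans dS (subD1set _ _).
  by apply/eqP/(out_perm dS); rewrite !inE eqxx.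
apply/subsetP=> z zd; rewrite !inE (subsetP dS) // andbT.
by apply: contraTneq zd => ->; rewrite inE dx eqxx.
Qed.

(** The transposition merges the fixed point [x] into the orbit of [y]: one orbit fewer, one point
    more, so the sum in [long] is unchanged. *)
Lemma long_insert S x y d : x \in S -> y \in S :\ x -> d x = x ->
  long S (tperm x y * d) = long (S :\ x) d.
Proof.
move=> xS; rewrite !inE => /andP[yx yS] dx.
rewrite /long perm_on_tpermM // perm_onD1 dx eqxx andbT.
have xNy : x \notin porbit d y.
  by rewrite porbit_sym; apply/porbitP=> -[i]; rewrite permX_fix //; exact/eqP.
have := porbits_mul_tperm d x y; rewrite /= xNy eq_sym yx.
by rewrite [#|S|](cardsD1 x) xS; lia.
Qed.

(** As [a] fixes [x], the transposition moves in front of [a], with [a^-1 y] in place of [y]. *)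
Lemma long_insert_mid S x y a d : x \in S -> y \in S :\ x ->
    perm_on (S :\ x) a -> d x = x ->
  long S (a * tperm x y * d) = long (S :\ x) (a * d).
Proof.
move=> xS yS; rewrite perm_onD1 => /andP[aS /eqP ax] dx.
have -> : a * tperm x y = tperm x (a^-1 y) * a.
  by rewrite -{1}[x]ax -{1}[y](permKV a) -tpermJ conjgE !mulgA mulgV mul1g.
rewrite -mulgA long_insert ?permM ?ax //.
have aSx : perm_on (S :\ x) a by rewrite perm_onD1 aS ax eqxx.
by rewrite (perm_closed _ (perm_onV aSx)).
Qed.

(** Points outside [S] are orbits by themselves, and [S] contributes at least one more. So [long]
    asks for the least possible number of orbits. *)
Lemma card_porbits_perm_on S c :
  S != set0 -> perm_on S c -> (#|T|.+1 <= #|porbits c| + #|S|)%N.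
Proof.
case/set0Pn=> x xS cS.
have cfix z : z \notin S -> porbit c z = [set z].
  move=> zS; apply/setP=> u; rewrite inE; apply/porbitP/eqP=> [[i ->]|->].
    by rewrite permX_fix // (out_perm cS).
  by exists 0; rewrite expg0 perm1.
have inj : {in x |: ~: S &, injective (porbit c)}.
  move=> u v; rewrite !inE => /predU1P[-> | uS] /predU1P[-> | vS] //.
  - move=> E; have := porbit_id c x; rewrite E cfix // inE => /eqP xv.
    by rewrite xv.
  - move=> E; have := porbit_id c x; rewrite -E cfix // inE => /eqP xv.
    by rewrite xv.
  - by move=> E; have := porbit_id c u; rewrite E cfix // inE => /eqP.
have : #|[set porbit c z | z in x |: ~: S]| <= #|porbits c|.
  by apply/subset_leq_card/subsetP=> _ /imsetP[z _ ->]; exact: imset_f.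
by rewrite card_in_imset // cardsU1 !inE xS /= -(cardsC S); lia.
Qed.

Lemma long_neq S c x : long S c -> x \in S -> (1 < #|S|)%N -> c x != x.
Proof.
case/andP=> cS /eqP card_c xS S1; apply/eqP=> cx.
have S'0 : S :\ x != set0.
  by rewrite -card_gt0; move: S1; rewrite (cardsD1 x) xS; lia.
have := @card_porbits_perm_on _ c S'0; rewrite perm_onD1 cS cx eqxx => /(_ isT).
by move: card_c; rewrite (cardsD1 x) xS; lia.
Qed.

Lemma long_out S c x : long S c -> x \notin S -> c x = x.
Proof. by case/andP=> cS _; exact: out_perm. Qed.

(** * Sums over long cycles, by deletion of a point *)

Lemma big_long_arrow S x y (F : {perm T} -> nat) :
    x \in S -> y \in S :\ x ->
  \sum_(c | long S c && (c y == x)) F c =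
  \sum_(d | long (S :\ x) d) F (tperm x y * d)%g.
Proof.
move=> xS yS.
(* This involution exchanges the cycles on [S] sending [y] to [x] with the cycles on [S :\ x]. *)
rewrite (reindex_onto (mulg (tperm x y)) (mulg (tperm x y))) /=; last first.
  by move=> c _; rewrite mulgA tperm2 mul1g.
apply: eq_bigl => d; rewrite mulgA tperm2 mul1g eqxx andbT permM tpermR.
apply/andP/idP => [[cS /eqP dx] | dS]; first by rewrite -(long_insert xS yS).
have dx : d x = x by apply: long_out dS _; rewrite !inE eqxx.
by rewrite long_insert // dx eqxx.
Qed.

Lemma big_long_preimage S x (F : {perm T} -> nat) :
    x \in S -> (1 < #|S|)%N ->
  \sum_(c | long S c) F c =
  \sum_(y in S :\ x) \sum_(d | long (S :\ x) d) F (tperm x y * d)%g.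
Proof.
move=> xS S1.
rewrite (partition_big (fun c => c^-1 x) [in S :\ x]) => [|c cS]; last first.
  rewrite !inE -(perm_closed _ (proj1 (andP cS))) permKV xS andbT.
  by apply: contraNneq (long_neq cS xS S1) => {1}<-; rewrite permKV.
apply: eq_bigr => y yS; rewrite -big_long_arrow //; apply: eq_bigl => c.
by rewrite -(inj_eq (@perm_inj _ c)) permKV eq_sym.
Qed.

(** Here the deleted point is the image [y] of [w], so the smaller set varies; in [nfact_moved], [y]
    becomes the new fixed point. *)
Lemma big_long_image S w (F : {perm T} -> nat) :
    w \in S -> (1 < #|S|)%N ->
  \sum_(c | long S c) F c =
  \sum_(y in S :\ w) \sum_(d | long (S :\ y) d) F (tperm w y * d)%g.
Proof.
move=> wS S1.
rewrite (partition_big (fun c => c w) [in S :\ w]) => [|c cS]; last first.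
  by rewrite !inE (long_neq cS wS S1) (perm_closed _ (proj1 (andP cS))).
apply: eq_bigr => y; rewrite !inE => /andP[yw yS].
rewrite big_long_arrow ?inE ?wS 1?eq_sym ?yw //.
by apply: eq_bigr => d _; rewrite tpermC.
Qed.

Lemma card_long S : S != set0 -> #|long S| = (#|S|.-1)`!.
Proof.
elim: {S}_.+1 {-2}S (ltnSn #|S|) => // n IHn S leSn S0.
have [x xS] := set0Pn _ S0.
rewrite -(sum1_card (long S)); have [S1 | S1] := leqP #|S| 1.
  have {}S1 : S = [set x].
    by apply/eqP; rewrite eq_sym eqEcard cards1 S1 sub1set xS.
  rewrite S1 cards1 (big_pred1 1) // => c; rewrite /= unfold_in.
  apply/andP/eqP => [[cS _] | ->]; first by apply: perm_on_id cS _; rewrite cards1.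
  rewrite perm_on1 cards1 addn1 eqSS /porbits card_imset ?cardT -?cardE //.
  move=> u v E; have := porbit_id 1 u; rewrite E => /porbitP[i].
  by rewrite expg1n perm1.
rewrite (@big_long_preimage _ x (fun=> 1%N)) //.
have cS : #|S :\ x| = #|S|.-1 by rewrite (cardsD1 x S) xS.
have S'0 : S :\ x != set0 by rewrite -card_gt0 cS; lia.
have cl : #|long (S :\ x)| = (#|S|.-2)`! by rewrite IHn ?cS //; lia.
rewrite (eq_bigr (fun=> (#|S|.-2)`!)) => [|y _]; last by rewrite sum1_card.
by rewrite sum_nat_const cS; case: #|S| S1 => [|[]].
Qed.

(* The number of factorizations [a = c d^-1] with [c] a cycle on [S] and [d] a
   cycle on [S :\ x]. *)
Definition nfact S x a := \sum_(d | long (S :\ x) d) long S (a * d).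

(** * Recursions for [nfact] *)

Lemma nfact_fix S x a : x \in S -> (1 < #|S|)%N -> a x = x -> nfact S x a = 0.
Proof.
move=> xS S1 ax; rewrite /nfact big1 // => d; rewrite /long perm_onD1.
case/andP=> /andP[_ /eqP dx] _; apply/eqP; rewrite eqb0.
by apply/negP=> /long_neq-/(_ _ xS S1); rewrite permM ax dx eqxx.
Qed.

(** Here [x] is cut out of its cycle: its preimage is now sent to [a x]. *)
Lemma perm_on_remove S x a : x \in S -> perm_on S a ->
  perm_on (S :\ x) (a * tperm x (a x)).
Proof.
move=> xS aS; rewrite perm_onD1 permM tpermR eqxx andbT.
by rewrite perm_onM // perm_on_tperm // (perm_closed _ aS).
Qed.

Lemma nfact_remove S x a : x \in S -> perm_on S a -> a x != x ->
  nfact S x a = \sum_(d | long (S :\ x) d) long (S :\ x) (a * tperm x (a x) * d).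
Proof.
move=> xS aS ax; apply: eq_bigr => d dSx.
have dx : d x = x by apply: long_out dSx _; rewrite !inE eqxx.
have wS : a x \in S :\ x by rewrite !inE ax (perm_closed _ aS).
rewrite -(long_insert_mid xS wS (perm_on_remove xS aS) dx).
by rewrite -!mulgA (mulgA (tperm _ _)) tperm2 mul1g.
Qed.

(** Deletes [x] from the cycle [d], with [y] its preimage there. The factor [a * tperm x y] still
    sends [x] to [a x], and [x] is cut out of it as well. *)
Lemma nfact_other S x z a : x \in S -> z \in S :\ x -> (2 < #|S|)%N ->
    perm_on S a -> a x != x ->
  nfact S z a = \sum_(y in S :\ x :\ (a x) :\ z)
                   nfact (S :\ x) z (a * tperm x y * tperm x (a x)).
Proof.
move=> xS /[dup] zSx; rewrite !inE => /andP[zx zS] S2 aS ax.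
have wS : a x \in S by rewrite (perm_closed _ aS).
rewrite /nfact (@big_long_preimage _ x); last 2 first.
- by rewrite !inE eq_sym zx.
- by move: S2; rewrite (cardsD1 z) zS; lia.
have setE : S :\ z :\ x = S :\ x :\ z by rewrite !setDDl setUC.
(* For [y = a x] the product would fix [x], which a cycle on [S] cannot do. *)
rewrite setE (bigID (pred1 (a x))) /= big1 ?add0n => [|y]; last first.
  case/andP=> _ /eqP ->; apply: big1 => d dSxz.
  have dx : d x = x by apply: long_out dSxz _; rewrite !inE eqxx andbF.
  apply/eqP; rewrite eqb0; apply/negP.
  move/long_neq=> /(_ x xS); rewrite !permM tpermR dx eqxx => H.
  by have := H (ltnW S2).
have predE y : (y \in S :\ x :\ z) && ~~ (y == a x) = (y \in S :\ x :\ a x :\ z).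
  by rewrite !inE andbC andbCA.
rewrite (eq_bigl _ _ predE); apply: eq_bigr => y.
rewrite !inE => /and4P[yz yw yx yS]; apply: eq_bigr => d dSxz.
have dx : d x = x by apply: long_out dSxz _; rewrite !inE eqxx andbF.
pose b := a * tperm x y.
have bS : perm_on S b by rewrite perm_onM // perm_on_tperm.
have bx : b x = a x by rewrite permM tpermD // eq_sym.
have wSx : a x \in S :\ x by rewrite !inE ax.
have := perm_on_remove xS bS; rewrite bx => b'S.
rewrite -(long_insert_mid xS wSx b'S dx) mulgA.
by rewrite -[b * _ * _]mulgA tperm2 mulg1.
Qed.


(** Conjugation by [tperm x w]; it gives the terms of [nfact_moved] the same shape as those of
    [nfact_other]. *)
Lemma tpermMM x y w : x != y -> x != w -> w != y ->
  tperm x y * tperm x w = tperm x w * tperm w y.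
Proof.
move=> xy xw wy; rewrite -{1}(mul1g (tperm x y)) -(tperm2 x w) -!mulgA.
congr (_ * _); rewrite -{1}(tpermV x w) -(conjgE _ (tperm x w)) tpermJ.
by rewrite tpermL tpermD // eq_sym.
Qed.

(** Once [x] is cut out of [a], the cycle [d] is split by its image [y] of [a x]; deleting [y]
    leaves a cycle on the points other than [x] and [y]. *)
Lemma nfact_moved S x a : x \in S -> (2 < #|S|)%N -> perm_on S a ->
    a x != x ->
  nfact S x a = \sum_(y in S :\ x :\ a x)
                   nfact (S :\ x) y (a * tperm x y * tperm x (a x)).
Proof.
move=> xS S2 aS ax; rewrite nfact_remove // (@big_long_image _ (a x)).
- apply: eq_bigr => y; rewrite !inE => /and3P[yw yx yS]; apply: eq_bigr => d _.
  by rewrite -[a * tperm x y * _]mulgA tpermMM ?mulgA // eq_sym.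
- by rewrite !inE ax (perm_closed _ aS).
- by move: S2; rewrite (cardsD1 x) xS; lia.
Qed.

(* Summed over all fixed points, the recursions for [nfact] collapse: the term
   [nfact S x a] is exactly what is missing from the sum over the other points
   for the induction hypothesis to apply to each [a * (x y) * (x a(x))]. *)
Theorem sum_nfact S a m : perm_on S a -> odd_perm a -> #|S| = m.+2 ->
  \sum_(x in S) nfact S x a = (2 * m`!)%N.
Proof.
elim: m S a => [|m IHm] S a aS odd_a cardS.
  all: have [x ax] : exists x, a x != x.
    1,3: apply/existsP; rewrite -negb_forall; apply: contraL odd_a.
    1,2: move=> /forallP a1; suff -> : a = 1 by rewrite odd_perm1.
    1,2: by apply/permP=> z; rewrite perm1; apply/eqP/a1.
  all: have xS : x \in S by apply: contraNT ax => xS; rewrite (out_perm aS).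
  all: have wS : a x \in S by rewrite (perm_closed _ aS).
  all: have cSx : #|S :\ x| = #|S|.-1 by rewrite (cardsD1 x S) xS.
  all: have cSxw : #|S :\ x :\ a x| = #|S|.-2
         by rewrite -cSx (cardsD1 (a x) (S :\ x)) !inE ax wS.
  (* On two points, cutting out a moved [z] leaves the identity and a single choice of [d]; each
     point then contributes 1. *)
  have nfact1 z b : z \in S -> perm_on S b -> b z != z -> nfact S z b = 1%N.
    move=> zS bS bz; rewrite nfact_remove //.
    have cSz : #|S :\ z| = 1%N by move: cardS; rewrite (cardsD1 z) zS; lia.
    have b1 : b * tperm z (b z) = 1.
      by apply: perm_on_id (perm_on_remove zS bS) _; rewrite cSz.
    rewrite b1 (eq_bigr (fun=> 1%N)) => [|d dS]; last by rewrite mul1g dS.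
    by rewrite sum1_card card_long ?cSz // -card_gt0 cSz.
  rewrite (eq_bigr (fun=> 1%N)); first by rewrite sum1_card cardS.
  move=> z zS; rewrite nfact1 //; apply: contraTneq odd_a => az.
  have az' : perm_on (S :\ z) a by rewrite perm_onD1 aS az eqxx.
  have cSz : #|S :\ z| <= 1 by move: cardS; rewrite (cardsD1 z) zS; lia.
  by rewrite (perm_on_id az' cSz) odd_perm1.
rewrite (big_setD1 x) //= nfact_moved ?cardS //.
rewrite (eq_bigr _ (fun z zS => nfact_other xS zS _ aS ax)) ?cardS //.
rewrite (exchange_big_dep [in S :\ x :\ a x]) /=; last first.
  by move=> z y _; rewrite !inE => /andP[].
rewrite -big_split /=.
(* The m + 1 values of [y] each give 2 m! by induction. *)
rewrite (eq_bigr (fun=> (2 * m`!)%N)) ?sum_nat_const ?cSxw ?cardS /=.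
  by rewrite factS; lia.
move=> y; rewrite !inE => /and3P[yw yx yS].
pose b := a * tperm x y.
have bS : perm_on S b by rewrite perm_onM // perm_on_tperm.
have bx : b x = a x by rewrite permM tpermD // eq_sym.
have := perm_on_remove xS bS; rewrite bx => b'S.
rewrite -(IHm (S :\ x) (b * tperm x (a x))) ?cSx ?cardS //; last first.
  by rewrite !odd_permM !odd_tperm odd_a ![x == _]eq_sym yx ax.
(* The term at [y] comes from [nfact_moved], the others from [nfact_other]. *)
rewrite [RHS](big_setD1 y) /= ?inE ?yx //; congr (_ + _)%N.
apply: eq_bigl => z; rewrite !inE yx yS yw (eq_sym y).
by case: (z == y); case: (z == x); case: (z \in S).
Qed.

End LongCycles.

(** * Cycle types *)

Section CycleTypes.

Set Implicit Arguments.
Unset Strict Implicit.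
Local Open Scope group_scope.

(** Serves both conjugation and the lift of ['I_n] into ['I_n.+1]. *)
Lemma porbit_inj (T U : finType) (f : T -> U) (s : {perm T}) (t : {perm U}) x :
  (forall z, t (f z) = f (s z)) -> porbit t (f x) = f @: porbit s x.
Proof.
move=> tf; have tfX i : (t ^+ i) (f x) = f ((s ^+ i) x).
  by elim: i => [|i IHi]; rewrite ?perm1 // !expgSr !permM IHi tf.
apply/setP=> u; apply/porbitP/imsetP => [[i ->] | [_ /porbitP[i ->] ->]].
  by exists ((s ^+ i) x); rewrite ?mem_porbit.
by exists i.
Qed.

Variable T : finType.
Implicit Types (s g a c d : {perm T}) (x y : T) (i : nat) (l : seq nat).

Lemma card_porbitJ s g x : #|porbit (s ^ g) (g x)| = #|porbit s x|.
Proof.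
rewrite (@porbit_inj _ _ g s) ?card_imset //; first exact: perm_inj.
by move=> z; rewrite permJ.
Qed.

Lemma mem_cycle_type s x : #|porbit s x| \in cycle_type s.
Proof.
by rewrite mem_sort; apply: map_f; rewrite mem_enum; exact: imset_f.
Qed.

Lemma cycle_type_gt0 s : 0 \notin cycle_type s.
Proof.
rewrite mem_sort; apply/mapP=> -[X]; rewrite mem_enum => /imsetP[x _ ->] /esym/eqP.
by apply/negP; exact: card_porbit_neq0.
Qed.

Lemma size_cycle_type s : size (cycle_type s) = #|porbits s|.
Proof. by rewrite size_sort size_map -cardE. Qed.

Lemma sorted_cycle_type s : sorted geq (cycle_type s).
Proof. by apply: sort_sorted => m n; exact: leq_total. Qed.

(** The orbits of size [i] partition the points counted on the right into blocks of size [i]. Types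
    can thus be compared by counting points. *)
Lemma mult_cycle_type s i :
  (i * mult i (cycle_type s) = \sum_x (#|porbit s x| == i))%N.
Proof.
have -> : mult i (cycle_type s) = #|[set X in porbits s | #|X| == i]|.
  rewrite /mult /cycle_type (seq.permP (permEl (perm_sort _ _))) count_map.
  rewrite cardE -size_filter /enum_mem -filter_predI; congr (size _).
  by apply: eq_filter => X; rewrite /= !inE andbC.
rewrite mulnC -big_mkcond sum1dep_card.
rewrite -(@card_uniform_partition _ i _ [set x | #|porbit s x| == i]) //.
  by move=> X; rewrite inE => /andP[_ /eqP].
have nz : [set X in porbits s | #|X| == i] =
    porbit s @: [set x | #|porbit s x| == i].
  apply/setP=> X; rewrite inE; apply/andP/imsetP => [[/imsetP[x _ ->] xi]|[x]].
    by exists x; rewrite ?inE.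
  by rewrite inE => xi ->; rewrite imset_f.
apply/and3P; split.
- apply/eqP/setP=> x; rewrite nz; apply/bigcupP/idP => [[_ /imsetP[y yi ->]]|xi].
    by rewrite -eq_porbit_mem => /eqP E; rewrite inE E; rewrite inE in yi.
  by exists (porbit s x); rewrite ?porbit_id // imset_f.
- rewrite nz; apply/trivIsetP=> _ _ /imsetP[x _ ->] /imsetP[y _ ->].
  apply: contraR => /pred0Pn[z /andP[/= zx zy]].
  by move: zx zy; rewrite -!eq_porbit_mem => /eqP-> .
rewrite nz; apply/imsetP=> -[x _ E]; have := porbit_id s x.
by rewrite -E inE.
Qed.

Lemma geq_trans : transitive geq.
Proof. by move=> m n p /= nm mp; exact: leq_trans mp nm. Qed.

Lemma geq_anti : antisymmetric geq.
Proof. by move=> m n /= mn; apply: anti_leq; rewrite andbC. Qed.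

Lemma cycle_type_mult s l : sorted geq l -> 0 \notin l ->
    (forall i, 0 < i -> (i * mult i l = \sum_x (#|porbit s x| == i))%N) ->
  cycle_type s = l.
Proof.
move=> l_sorted l_gt0 lE.
apply: (sorted_eq geq_trans geq_anti (sorted_cycle_type s) l_sorted).
apply/allP=> -[_ | i _] /=; last first.
  by rewrite -(eqn_pmul2l (ltn0Sn i)) -/(mult _ _) mult_cycle_type -lE.
by rewrite (count_memPn (cycle_type_gt0 s)) (count_memPn l_gt0).
Qed.

Lemma cycle_typeJ s g : cycle_type (s ^ g) = cycle_type s.
Proof.
apply: cycle_type_mult (sorted_cycle_type s) (cycle_type_gt0 s) _ => i _.
rewrite mult_cycle_type [RHS](reindex_inj (@perm_inj _ g)).
by apply: eq_bigr => x _; rewrite card_porbitJ.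
Qed.

Lemma long_setT s : long [set: T] s = (#|porbits s| == 1%N).
Proof.
rewrite /long cardsT -add1n eqn_add2r andb_idl // => _.
exact/subsetP.
Qed.

Lemma porbit_long s x : long [set: T] s -> porbit s x = [set: T].
Proof.
rewrite long_setT => /cards1P[X E]; have porbitE y : porbit s y = X.
  by apply/set1P; rewrite -E imset_f.
by apply/setP=> y; rewrite (porbitE x) -(porbitE y) porbit_id inE.
Qed.

Lemma long_setTE s : 0 < #|T| -> (cycle_type s == [:: #|T|]) = long [set: T] s.
Proof.
move=> /card_gt0P[x _]; apply/eqP/idP => [ct | s_long].
  by rewrite long_setT -size_cycle_type ct.
rewrite /cycle_type; have -> : porbits s = [set [set: T]].
  apply/setP=> X; rewrite !inE; apply/imsetP/eqP => [[y _ ->] | ->].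
    exact: porbit_long.
  by exists x; rewrite ?porbit_long.
by rewrite enum_set1 /= cardsT.
Qed.

Lemma longJ s g : long [set: T] (s ^ g) = long [set: T] s.
Proof. by rewrite !long_setT -!size_cycle_type cycle_typeJ. Qed.

Lemma long_setD1 x d :
  long (setT :\ x) d = (d x == x) && (#|porbits d| == 2).
Proof.
rewrite /long perm_onD1 (_ : perm_on setT d) //=; last exact/subsetP.
have : #|[set: T]| = (#|[set: T] :\ x|).+1 by rewrite (cardsD1 x) inE.
by rewrite cardsT => ->; congr (_ && _); lia.
Qed.

Lemma nfactJ x a g : nfact setT (g x) (a ^ g) = nfact setT x a.
Proof.
rewrite /nfact (reindex_inj (conjg_inj g)) /=; apply: eq_big => d.
  rewrite !long_setD1 permJ (inj_eq perm_inj).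
  by rewrite -!size_cycle_type cycle_typeJ.
by move=> _; rewrite -conjMg longJ.
Qed.

(** Conjugation by [tperm x y] exchanges the two points and keeps the type. *)
Lemma sum_cycle_type_nfact x y (l : seq nat) :
  \sum_(a | cycle_type a == l) nfact setT x a =
  \sum_(a | cycle_type a == l) nfact setT y a.
Proof.
rewrite (reindex_inj (conjg_inj (tperm x y))) /=; apply: eq_big => a.
  by rewrite cycle_typeJ.
by move=> _; rewrite -(nfactJ y a (tperm x y)) tpermR.
Qed.

End CycleTypes.

(** * Partitions *)

Section Partitions.

Set Implicit Arguments.
Unset Strict Implicit.

Implicit Types (l mu : seq nat) (i j n : nat).

Lemma is_partitionE n l :
  is_partition n l = [&& sorted geq l, 0 \notin l & sumn l == n].
Proof.
rewrite /is_partition; congr [&& _, _ & _].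
elim: l => // x l IHl; rewrite /= IHl in_cons negb_or.
by rewrite lt0n eq_sym.
Qed.

Lemma sort_geq_eq l mu : sorted geq mu -> (sort geq l == mu) = perm_eq l mu.
Proof.
move=> mu_sorted; apply/eqP/idP => [<- | lmu].
  by rewrite perm_sym perm_sort.
apply: (sorted_eq geq_trans geq_anti _ mu_sorted); last by rewrite perm_sort.
by apply: sort_sorted => m n; exact: leq_total.
Qed.

Lemma sort_geq_sorted l : sorted geq (sort geq l).
Proof. by apply: sort_sorted => m n; exact: leq_total. Qed.

Lemma sumn_perm l mu : perm_eq l mu -> sumn l = sumn mu.
Proof. by move=> lmu; rewrite !sumnE; exact: perm_big. Qed.

Lemma sumn_rem i l : i \in l -> sumn l = i + sumn (rem i l).
Proof. by move=> il; rewrite (sumn_perm (perm_to_rem il)). Qed.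

Lemma mult_cons i j l : mult i (j :: l) = (j == i) + mult i l.
Proof. by []. Qed.

Lemma mult_perm i l mu : perm_eq l mu -> mult i l = mult i mu.
Proof. by move=> lmu; rewrite /mult (seq.permP lmu). Qed.

Lemma mult_rem i j l : j \in l -> mult i l = (j == i) + mult i (rem j l).
Proof. by move=> jl; rewrite (mult_perm i (perm_to_rem jl)). Qed.

Lemma mult_down i j l : mult i (down j l) = (j.-1 == i) + mult i (rem j l).
Proof. by rewrite (mult_perm _ (permEl (perm_sort _ _))). Qed.

Lemma partition_rem n i mu :
  is_partition (i + n) mu -> i \in mu -> is_partition n (rem i mu).
Proof.
rewrite !is_partitionE => /and3P[mu_sorted mu_gt0 /eqP mu_sum] imu.
apply/and3P; split.
- exact: subseq_sorted geq_trans _ _ (rem_subseq i mu) mu_sorted.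
- by apply: contra mu_gt0; exact: mem_rem.
by move: mu_sum; rewrite (sumn_rem imu) => /addnI ->.
Qed.

Lemma partition_down n i mu : 0 < i ->
  is_partition n.+1 mu -> i.+1 \in mu -> is_partition n (down i.+1 mu).
Proof.
rewrite !is_partitionE => i0 /and3P[mu_sorted mu_gt0 /eqP mu_sum] imu.
apply/and3P; split; first exact: sort_geq_sorted.
- rewrite mem_sort in_cons negb_or neq_ltn i0 /=.
  by apply: contra mu_gt0; exact: mem_rem.
rewrite (sumn_perm (permEl (perm_sort _ _))) /=.
by move: mu_sum; rewrite (sumn_rem imu) addSn => -[->].
Qed.

Lemma sumn_mult n l : all (gtn n) l -> sumn l = \sum_(i < n) i * mult i l.
Proof.
elim: l => [_ | x l IHl /andP[xn ln]].
  by rewrite big1 // => i _; rewrite muln0.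
rewrite -[LHS]/(x + sumn l) (IHl ln).
under [RHS]eq_bigr => i _ do rewrite mult_cons mulnDr.
rewrite big_split /=; congr (_ + _); rewrite (bigD1 (Ordinal xn)) // big1 => [|i].
  by rewrite /= eqxx muln1 addn0.
by rewrite -val_eqE eq_sym => /negPf /= ->; rewrite muln0.
Qed.

Lemma partition_leq n l i : is_partition n l -> i \in l -> i <= n.
Proof. by case/and3P=> _ _ /eqP <- il; rewrite (sumn_rem il) leq_addr. Qed.

Lemma zeeE l r : uniq r -> {subset l <= r} ->
  zee l = \prod_(i <- r) (i ^ mult i l * (mult i l)`!).
Proof.
move=> r_uniq lr; rewrite -(big_rmcond_in _ (P := [in l])) /=; last first.
  by move=> i _ il; rewrite /mult (count_memPn il).
rewrite -big_filter; apply/perm_big/uniq_perm; rewrite ?undup_uniq ?filter_uniq //.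
by move=> i; rewrite mem_undup mem_filter andb_idr // => /lr.
Qed.

Lemma zee_perm l mu : perm_eq l mu -> zee l = zee mu.
Proof.
move=> lmu; rewrite [RHS](@zeeE _ (undup l)) ?undup_uniq //.
  by apply: eq_bigr => i _; rewrite (mult_perm i lmu).
by move=> i; rewrite mem_undup (perm_mem lmu).
Qed.

Lemma zee_cons i l : zee (i :: l) = i * (mult i l).+1 * zee l.
Proof.
(* An index list common to both products, with the only changing factor in front. *)
pose r := i :: rem i (undup l).
have r_uniq : uniq r.
  by rewrite /= rem_uniq ?undup_uniq // mem_rem_uniq ?undup_uniq // !inE eqxx.
have rE : {subset i :: l <= r}.
  move=> j; rewrite !inE mem_rem_uniq ?undup_uniq // !inE mem_undup.
  by case: eqP.
rewrite (zeeE r_uniq rE) (zeeE r_uniq) => [|j jl]; last first.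
  by rewrite rE // inE jl orbT.
rewrite !big_cons mult_cons eqxx add1n expnS factS.
rewrite [in LHS](eq_big_seq (fun j => j ^ mult j l * (mult j l)`!)) => [|j].
  by rewrite !mulnA; congr (_ * _); lia.
rewrite mem_rem_uniq ?undup_uniq // !inE mult_cons => /andP[/negPf ji _].
by rewrite eq_sym ji.
Qed.

Lemma zee_rem i l : i \in l -> zee l = i * mult i l * zee (rem i l).
Proof.
move=> il; rewrite (zee_perm (perm_to_rem il)) zee_cons.
by rewrite (mult_rem i il) eqxx.
Qed.

(** Both values of [zee] are multiples of [zee (rem i.+1 mu)]. *)
Lemma zee_down i mu : i.+1 \in mu ->
  zee mu * (i * mult i (down i.+1 mu)) =
  zee (down i.+1 mu) * (i.+1 * mult i.+1 mu).
Proof.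
move=> imu; rewrite (zee_rem imu) (zee_perm (permEl (perm_sort _ _))) zee_cons.
by rewrite mult_down eqxx add1n mulnAC [RHS]mulnAC; congr (_ * _); exact: mulnC.
Qed.

(** Raising a part [i] to [i.+1] is undone by [down]. *)
Lemma down_eq i l mu : sorted geq l -> sorted geq mu -> i \in l ->
  (sort geq (i.+1 :: rem i l) == mu) = (i.+1 \in mu) && (l == down i.+1 mu).
Proof.
move=> l_sorted mu_sorted il; rewrite sort_geq_eq //.
rewrite eq_sym [in RHS]/down sort_geq_eq //=.
have lE := perm_to_rem il.
apply/idP/andP => [mulE | [imu lmu]].
  have imu : i.+1 \in mu by rewrite -(perm_mem mulE) mem_head.
  split=> //; rewrite perm_sym (perm_trans lE) // perm_cons.
  by rewrite -(perm_cons i.+1) (perm_trans mulE) // perm_to_rem.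
rewrite perm_sym (perm_trans (perm_to_rem imu)) // perm_cons.
by rewrite -(perm_cons i) (perm_trans lmu) // perm_to_rem.
Qed.

End Partitions.

(** * Inserting a point in a permutation *)

Section Insertion.

Set Implicit Arguments.
Unset Strict Implicit.
Local Open Scope group_scope.

Variable n : nat.
Implicit Types (s d : {perm 'I_n}) (a : {perm 'I_n.+1}) (x y : 'I_n).

Definition lft s : {perm 'I_n.+1} := lift_perm ord0 ord0 s.

(* Inserts the new point [ord0] right after [y] in its cycle. *)
Definition ins y s := tperm ord0 (lift ord0 y) * lft s.

Lemma lft0 s : lft s ord0 = ord0.
Proof. exact: lift_perm_id. Qed.

Lemma lft_lift s x : lft s (lift ord0 x) = lift ord0 (s x).
Proof. exact: lift_perm_lift. Qed.

Lemma lft_inj : injective lft.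
Proof.
move=> s t /permP E; apply/permP=> x; apply: (@lift_inj _ ord0).
by rewrite -!lft_lift E.
Qed.

Lemma lftM s d : lft (s * d) = lft s * lft d.
Proof. by rewrite /lft lift_permM. Qed.

Lemma lft_onto a : a ord0 = ord0 -> exists s, lft s = a.
Proof.
move=> a0; have H x : exists y, lift ord0 y == a (lift ord0 x).
  have /unlift_some[y -> _] : ord0 != a (lift ord0 x).
    by rewrite -{1}a0 (inj_eq perm_inj) neq_lift.
  by exists y.
pose f x := xchoose (H x); have fE x : lift ord0 (f x) = a (lift ord0 x).
  exact/eqP/(xchooseP (H x)).
have f_inj : injective f.
  by move=> x y E; apply/(@lift_inj _ ord0)/(@perm_inj _ a); rewrite -!fE E.
exists (perm f_inj); apply/permP=> z; case: (unliftP ord0 z) => [x|] ->.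
  by rewrite lft_lift permE fE.
by rewrite lft0.
Qed.

Lemma big_lft (P : pred {perm 'I_n.+1}) (F : {perm 'I_n.+1} -> nat) :
  \sum_(a | P a && (a ord0 == ord0)) F a = \sum_(s | P (lft s)) F (lft s).
Proof.
(* By [lft_onto], the default is never taken when [a] fixes [ord0]. *)
pose g a := odflt 1 [pick s | lft s == a].
rewrite (reindex_onto lft g) => [|a /andP[_ /eqP/lft_onto[s sa]]].
  apply: eq_bigl => s; rewrite lft0 eqxx andbT andb_idr // => _.
  by rewrite /g; case: pickP => [t /eqP/lft_inj-> | /(_ s)]; rewrite eqxx.
by rewrite /g; case: pickP => [t /eqP-> // | /(_ s)]; rewrite sa eqxx.
Qed.

Lemma big_perm_insert (F : {perm 'I_n.+1} -> nat) :
  \sum_a F a = (\sum_s F (lft s) + \sum_y \sum_s F (ins y s))%N.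
Proof.
(* Splits by the preimage of [ord0]: [ord0] itself for [lft s], [lift ord0 y] for [ins y s]. *)
pose f (a : {perm 'I_n.+1}) := (a^-1 : {perm 'I_n.+1}) ord0.
rewrite (partition_big f predT) //.
have E z : \sum_(a | f a == z) F a = \sum_s F (tperm ord0 z * lft s)%g.
  rewrite -(big_lft predT (fun a => F (tperm ord0 z * a)%g)).
  rewrite (reindex_inj (mulgI (tperm ord0 z))) /=; apply: eq_bigl => a; rewrite /f.
  by rewrite -(inj_eq (@perm_inj _ (tperm ord0 z * a))) permKV permM tpermR eq_sym.
rewrite big_ord_recl /= E tperm1; congr (_ + _)%N.
  by apply: eq_bigr => s _; rewrite mul1g.
by apply: eq_bigr => y _; rewrite E.
Qed.

Lemma porbit_lft s x : porbit (lft s) (lift ord0 x) = lift ord0 @: porbit s x.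
Proof. by apply: porbit_inj => z; rewrite lft_lift. Qed.

Lemma porbit_lft0 s : porbit (lft s) ord0 = [set ord0].
Proof.
apply/setP=> u; rewrite inE; apply/porbitP/eqP=> [[i ->] | ->].
  by rewrite permX_fix ?lft0.
by exists 0; rewrite expg0 perm1.
Qed.

Lemma ins_lift y s x : x != y -> ins y s (lift ord0 x) = lift ord0 (s x).
Proof.
by move=> xy; rewrite permM tpermD ?lft_lift ?neq_lift // (inj_eq lift_inj) eq_sym.
Qed.

Lemma porbit_closed (T : finType) (c : {perm T}) (A : {set T}) u :
  u \in A -> {in A, forall v, c v \in A} -> porbit c u \subset A.
Proof.
move=> uA cA; apply/subsetP=> _ /porbitP[i ->].
by elim: i => [|i IHi]; rewrite ?perm1 // expgSr permM cA.
Qed.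

Lemma porbit_ins0 y s :
  porbit (ins y s) ord0 = ord0 |: lift ord0 @: porbit s y.
Proof.
have ins0 : ins y s ord0 = lift ord0 (s y) by rewrite permM tpermL lft_lift.
have insy : ins y s (lift ord0 y) = ord0 by rewrite permM tpermR lft0.
have porbitS (T : finType) (c : {perm T}) z : porbit c (c z) = porbit c z.
  by rewrite -{2}(expg1 c) porbit_perm.
apply/eqP; rewrite eqEsubset; apply/andP; split.
  apply: porbit_closed; first exact: setU11.
  move=> _ /setU1P[-> | /imsetP[x xy ->]].
    by rewrite ins0 in_setU1 imset_f ?orbT // -(porbitS _ s) porbit_id.
  have [-> | ne] := eqVneq x y; first by rewrite insy setU11.
  rewrite ins_lift // in_setU1 imset_f ?orbT //.
  by rewrite -eq_porbit_mem porbitS eq_porbit_mem.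
rewrite subUset sub1set porbit_id /=.
apply/subsetP=> _ /imsetP[x /porbitP[i ->] ->].
(* Exponents start at 1 because [ord0] is sent to the lift of [s y]; when the walk meets [y], the
   next point is that image again. *)
have orb k : lift ord0 ((s ^+ k.+1) y) \in porbit (ins y s) ord0.
  elim: k => [|k IHk].
    by rewrite expg1 -ins0 -(porbitS _ (ins y s)) porbit_id.
  rewrite expgSr permM; have [-> | ne] := eqVneq ((s ^+ k.+1) y) y.
    by rewrite -ins0 -(porbitS _ (ins y s)) porbit_id.
  by rewrite -(ins_lift s ne) -eq_porbit_mem porbitS eq_porbit_mem.
case: i => [|k]; last exact: orb.
by rewrite expg0 perm1 -eq_porbit_mem -(porbitS _ (ins y s) (lift ord0 y)) insy.
Qed.

Lemma card_porbit_ins0 y s : #|porbit (ins y s) ord0| = #|porbit s y|.+1.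
Proof.
rewrite porbit_ins0 cardsU1 card_imset; last exact: lift_inj.
by case: imsetP => // -[x _ /eqP]; rewrite (negPf (neq_lift _ _)).
Qed.

Lemma card_porbit_ins y s x :
  #|porbit (ins y s) (lift ord0 x)| =
  if x \in porbit s y then #|porbit s y|.+1 else #|porbit s x|.
Proof.
case: ifPn => [xy | xNy].
  rewrite -(card_porbit_ins0 y s); congr #|pred_of_set _|; apply/eqP.
  by rewrite eq_porbit_mem porbit_ins0 in_setU1 imset_f ?orbT.
rewrite -(card_imset (mem (porbit s x)) (@lift_inj _ ord0)).
(* The walk from [x] avoids [y], the only old point at which [ins y s] departs from [s]. *)
have E k : (ins y s ^+ k) (lift ord0 x) = lift ord0 ((s ^+ k) x).
  elim: k => [|k IHk]; first by rewrite !expg0 !perm1.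
  rewrite expgSr permM IHk ins_lift; first by rewrite expgSr permM.
  apply: contraNneq xNy => <-.
  by rewrite porbit_sym mem_porbit.
apply: eq_card => u; apply/porbitP/imsetP => [[k ->] | [_ /porbitP[k ->] ->]].
  by exists ((s ^+ k) x); rewrite ?E // mem_porbit.
by exists k.
Qed.

Lemma cycle_type_lft s : cycle_type (lft s) = sort geq (1%N :: cycle_type s).
Proof.
apply: cycle_type_mult; first exact: sort_geq_sorted.
  by rewrite mem_sort inE cycle_type_gt0.
move=> i _; rewrite (mult_perm i (permEl (perm_sort _ _))) mult_cons mulnDr.
rewrite mult_cycle_type big_ord_recl porbit_lft0 cards1; congr (_ + _)%N.
  by case: eqP => [<- | _]; rewrite ?muln0.
apply: eq_bigr => x _; rewrite porbit_lft card_imset //; exact: lift_inj.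
Qed.

Lemma cycle_type_ins y s : cycle_type (ins y s) =
  sort geq (#|porbit s y|.+1 :: rem #|porbit s y| (cycle_type s)).
Proof.
apply: cycle_type_mult; first exact: sort_geq_sorted.
  by rewrite mem_sort inE; apply: contra (cycle_type_gt0 s); exact: mem_rem.
move=> i _; rewrite (mult_perm i (permEl (perm_sort _ _))) mult_cons mulnDr.
have := mult_cycle_type s i; rewrite (mult_rem i (mem_cycle_type s y)) mulnDr.
rewrite big_ord_recl card_porbit_ins0.
pose rest := \sum_(x | x \notin porbit s y) (#|porbit s x| == i).
have -> : \sum_x (#|porbit s x| == i) =
    (#|porbit s y| * (#|porbit s y| == i) + rest)%N.
  rewrite (bigID [in porbit s y]) /=; congr (_ + _)%N.
  rewrite -sum_nat_const; apply: eq_bigr => x.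
  by rewrite -eq_porbit_mem => /eqP ->.
have -> : \sum_x (#|porbit (ins y s) (lift ord0 x)| == i) =
    (#|porbit s y| * (#|porbit s y|.+1 == i) + rest)%N.
  rewrite (bigID [in porbit s y]) /= -sum_nat_const.
  congr (_ + _)%N; apply: eq_bigr => x xy; rewrite card_porbit_ins.
    by rewrite xy.
  by rewrite (negPf xy).
(* Trades orbit sizes for the factor [i], so that linear arithmetic concludes. *)
have muln_eq k : (k * (k == i) = i * (k == i))%N.
  by case: eqP => [-> | _]; rewrite ?muln0.
have := muln_eq #|porbit s y|.+1; have := muln_eq #|porbit s y|.
by rewrite mulSn; lia.
Qed.

End Insertion.

(** * Counting permutations by type *)

Section Counting.

Set Implicit Arguments.
Unset Strict Implicit.
Local Open Scope group_scope.

Variable n : nat.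
Implicit Types (s d : {perm 'I_n}) (a : {perm 'I_n.+1}) (mu : seq nat).

(** By [down_eq], [y] must lie in a cycle of length [i] of some [s] of type [down i.+1 mu]; such
    points number [i] times the multiplicity of [i]. *)
Lemma partition_count_ins mu s : is_partition n.+1 mu ->
  \sum_y (cycle_type (ins y s) == mu) =
  \sum_(1 <= i < n.+1 | i.+1 \in mu)
     (i * mult i (down i.+1 mu) * (cycle_type s == down i.+1 mu))%N.
Proof.
rewrite is_partitionE => /and3P[mu_sorted _ _].
under eq_bigr => y _ do rewrite cycle_type_ins
  (down_eq (sorted_cycle_type s) mu_sorted (mem_cycle_type s y)).
transitivity (\sum_y \sum_(1 <= i < n.+1 | i.+1 \in mu)
   ((#|porbit s y| == i) * (cycle_type s == down i.+1 mu))%N).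
  apply: eq_bigr => y _; set k := #|_|.
  have k_in : k \in index_iota 1 n.+1.
    rewrite mem_index_iota lt0n card_porbit_neq0 ltnS -[X in _ <= X]card_ord.
    exact: max_card.
  rewrite big_mkcond (bigD1_seq k) ?iota_uniq //= eqxx mul1n big1 ?addn0 => [|i].
    by case: ifP.
  by rewrite eq_sym => /negPf->; rewrite mul0n if_same.
rewrite exchange_big; apply: eq_bigr => i _; rewrite -big_distrl /=.
by rewrite -mult_cycle_type; case: eqP => [-> | _]; rewrite ?muln0.
Qed.

Lemma sum_cycle_type mu :
  \sum_(a : {perm 'I_n}) (cycle_type a == mu) = Acount n mu.
Proof. by rewrite /Acount -sum1dep_card [RHS]big_mkcond. Qed.

End Counting.

(** * Recursion and closed form for [Acount] *)

Section Recursions.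

Set Implicit Arguments.
Unset Strict Implicit.

Lemma Acount_rec n mu : is_partition n.+1 mu ->
  Acount n.+1 mu = (1 \in mu) * Acount n (rem 1 mu) +
    \sum_(1 <= i < n.+1 | i.+1 \in mu)
       i * mult i (down i.+1 mu) * Acount n (down i.+1 mu).
Proof.
move=> mu_part; have := mu_part; rewrite is_partitionE => /and3P[mu_sorted _ _].
rewrite -sum_cycle_type big_perm_insert; congr (_ + _).
  rewrite -sum_cycle_type big_distrr; apply: eq_bigr => s _ /=.
  rewrite cycle_type_lft sort_geq_eq // mulnb; congr nat_of_bool.
  have [mu1 | mu1] := boolP (1 \in mu); last first.
    by apply: contraNF mu1 => /perm_mem E; rewrite -E mem_head.
  rewrite (permPr (perm_to_rem mu1)) perm_cons -sort_geq_eq.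
    by rewrite (sorted_sort geq_trans (sorted_cycle_type s)).
  exact: subseq_sorted geq_trans _ _ (rem_subseq 1 mu) mu_sorted.
rewrite exchange_big /=.
under eq_bigr => s _ do rewrite partition_count_ins //.
rewrite exchange_big /=; apply: eq_bigr => i _.
by rewrite -big_distrr sum_cycle_type.
Qed.

Lemma Acount_zee n mu : is_partition n mu -> Acount n mu * zee mu = n`!.
Proof.
elim: n mu => [|n IHn] mu mu_part.
  have -> : mu = [::].
    by case: mu mu_part => // -[|x] l; rewrite is_partitionE // => /and3P[].
  rewrite /zee big_nil muln1 /Acount (_ : [set s | _] = setT).
    by rewrite cardsT card_Sn.
  apply/setP=> s; rewrite !inE -size_eq0 size_cycle_type cards_eq0.
  by apply/eqP/setP=> X; rewrite inE; apply/imsetP=> -[[]].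
have := mu_part; rewrite is_partitionE => /and3P[mu_sorted mu_gt0 /eqP mu_sum].
(* The factor n + 1 of (n + 1)! becomes the sum of the parts of [mu], to be matched term by term
   with [Acount_rec]. *)
have muE : n.+1 = mult 1 mu + \sum_(1 <= i < n.+1) i.+1 * mult i.+1 mu.
  rewrite -{1}mu_sum (@sumn_mult n.+2).
    rewrite -(big_mkord xpredT (fun i => i * mult i mu)) [LHS]big_ltn //.
    by rewrite big_ltn // mul1n big_add1.
  by apply/allP=> i /(partition_leq mu_part).
rewrite factS [X in _ = X * _]muE Acount_rec // !mulnDl !big_distrl big_mkcond /=.
congr (_ + _).
  have [mu1 | mu1] := boolP (1 \in mu); last by rewrite /mult (count_memPn mu1).
  rewrite (zee_rem mu1) !mul1n mulnCA IHn //.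
  exact: (@partition_rem n 1).
apply: eq_big_nat => i /andP[i0 _].
have [mui | mui] := boolP (i.+1 \in mu); last first.
  by rewrite /mult (count_memPn mui) muln0.
rewrite mulnC mulnA zee_down // -(IHn (down i.+1 mu)); last exact: partition_down.
by rewrite mulnAC mulnC; lia.
Qed.

(** * Factorizations of a given type, and [Bcount] *)

Lemma longcycle_conj n (c : {perm 'I_n.+1}) : long [set: 'I_n.+1] c ->
  exists g, c = (longcycle n.+1 ^ g)%g.
Proof.
move=> c_long; have card_orb : #|porbit c ord0| = n.+1.
  by rewrite porbit_long // cardsT card_ord.
(* The conjugating map lists the points in the order in which [c] visits them from [ord0]. *)
pose f (i : 'I_n.+1) := iter i c ord0.
have f_inj : injective f.
  move=> i j; rewrite /f.
  rewrite -!(nth_traject c (_ : _ < n.+1)) ?ltn_ord // => /eqP.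
  rewrite nth_uniq ?size_traject ?ltn_ord // => [/eqP/val_inj //|].
  by have := uniq_traject_porbit c ord0; rewrite card_orb.
exists (perm f_inj); apply/permP=> x.
rewrite -[x in RHS](permKV (perm f_inj)) permJ -{1}(permKV (perm f_inj) x).
move: ((perm f_inj)^-1%g x) => i; rewrite !permE /f /= -iterS.
have [-> | ne] := eqVneq i ord_max.
  by rewrite /= modnn -iterS; have := iter_porbit c ord0; rewrite card_orb.
by rewrite modn_small // ltnS ltn_neqAle ne -ltnS ltn_ord.
Qed.

Lemma Bcount_conj n (c : {perm 'I_n.+1}) l : long [set: 'I_n.+1] c ->
  \sum_(s | cycle_type s == l) long [set: 'I_n.+1] (s^-1 * c)%g = Bcount n.+1 l.
Proof.
case/longcycle_conj => g ->; rewrite /Bcount -sum1dep_card.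
rewrite (reindex_inj (conjg_inj g)) /= [RHS]big_mkcondr /=; apply: eq_big => s.
  by rewrite cycle_typeJ.
by move=> _; rewrite -conjVg -conjMg longJ -long_setTE ?card_ord.
Qed.

Lemma big_long_lft n (F : {perm 'I_n.+1} -> nat) :
  \sum_(d | long (setT :\ ord0) d) F d =
  \sum_(d | long [set: 'I_n] d) F (lft d).
Proof.
transitivity (
    \sum_(d : {perm 'I_n.+1} | (#|porbits d| == 2) && (d ord0 == ord0)) F d).
  by apply: eq_bigl => d; rewrite long_setD1 andbC.
rewrite (big_lft (fun d => #|porbits d| == 2)); apply: eq_bigl => d.
by rewrite long_setT -!size_cycle_type cycle_type_lft size_sort.
Qed.

Lemma nfact_lft n s : 0 < n -> nfact [set: 'I_n.+1] ord0 (lft s) = 0.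
Proof. by move=> n0; rewrite nfact_fix ?inE ?lft0 // cardsT card_ord. Qed.

(** Deleting [ord0] leaves products of permutations of the n old points, so the count does not
    depend on [y]. *)
Lemma nfact_ins n (y : 'I_n) s : nfact [set: 'I_n.+1] ord0 (ins y s) =
  \sum_(d | long [set: 'I_n] d) long [set: 'I_n] (s * d)%g.
Proof.
rewrite /nfact big_long_lft; apply: eq_bigr => d _.
rewrite /ins -mulgA -lftM long_insert ?inE ?lft0 //.
rewrite long_setD1 lft0 eqxx long_setT -!size_cycle_type cycle_type_lft.
by rewrite size_sort.
Qed.

Lemma sum_nfact_ins n l :
  \sum_(s | cycle_type s == l)
     \sum_(d | long [set: 'I_n.+1] d) long [set: 'I_n.+1] (s * d)%g =
  n`! * Bcount n.+1 l.
Proof.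
transitivity (\sum_(s | cycle_type s == l)
     \sum_(c | long [set: 'I_n.+1] c) long [set: 'I_n.+1] (s^-1 * c)%g).
  apply: eq_bigr => s _; rewrite [LHS]big_mkcond [RHS]big_mkcond.
  (* Substitutes [c = s * d]. *)
  rewrite [RHS](reindex_inj (mulgI s)); apply: eq_bigr => d _ /=.
  by rewrite mulKg; do 2!case: (long _ _).
rewrite exchange_big /= (eq_bigr (fun=> Bcount n.+1 l)); last first.
  by move=> c; exact: Bcount_conj.
rewrite sum_nat_const card_long ?cardsT ?card_ord //.
by apply/set0Pn; exists ord0.
Qed.

Lemma sum_nfact_ord0 n mu : 0 < n -> is_partition n.+1 mu ->
  \sum_(a | cycle_type a == mu) nfact [set: 'I_n.+1] ord0 a =
  n.-1`! * \sum_(1 <= i < n.+1 | i.+1 \in mu)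
             (i * mult i (down i.+1 mu) * Bcount n (down i.+1 mu)).
Proof.
(* Permutations fixing [ord0] contribute nothing, by [nfact_lft]. *)
case: n => // n _ mu_part; rewrite big_mkcond big_perm_insert big1 ?add0n.
  rewrite exchange_big /=.
  pose W (s : {perm 'I_n.+1}) :=
    \sum_(d | long [set: 'I_n.+1] d) long [set: 'I_n.+1] (s * d)%g.
  transitivity (\sum_s (\sum_y (cycle_type (ins y s) == mu)) * W s).
    apply: eq_bigr => s _; rewrite big_distrl; apply: eq_bigr => y _ /=.
    by rewrite nfact_ins; case: eqP; rewrite ?mul1n.
  under eq_bigr => s _ do rewrite partition_count_ins // big_distrl /=.
  rewrite exchange_big big_distrr; apply: eq_bigr => i _ /=.
  rewrite mulnCA -sum_nfact_ins big_distrr [RHS]big_mkcond /=.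
  by apply: eq_bigr => s _; case: eqP; rewrite ?muln1 ?muln0.
by move=> s _; rewrite nfact_lft ?if_same.
Qed.

Lemma sum_nfact_cycle_type n mu : 0 < n -> is_partition n.+1 mu ->
    odd (size mu) = odd n ->
  n.+1 * \sum_(a | cycle_type a == mu) nfact [set: 'I_n.+1] ord0 a =
  Acount n.+1 mu * (2 * n.-1`!).
Proof.
move=> n0 mu_part mu_odd.
(* By conjugacy the factor n + 1 becomes a sum over all fixed points, to which [sum_nfact]
   applies. *)
transitivity (\sum_(x : 'I_n.+1) \sum_(a | cycle_type a == mu) nfact setT x a).
  under [RHS]eq_bigr => x _ do rewrite (sum_cycle_type_nfact x ord0).
  by rewrite sum_nat_const card_ord.
rewrite exchange_big /= (eq_bigr (fun=> 2 * n.-1`!)) => [|a /eqP ct_a].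
  by rewrite sum_nat_const /Acount cardsE.
rewrite -(@sum_nfact _ setT a) ?cardsT ?card_ord ?prednK //.
- by apply: eq_bigl => x; rewrite inE.
- exact/subsetP.
(* The sign is the parity of n + 1 plus the number of cycles, hence odd by [mu_odd]. *)
by rewrite /odd_perm card_ord -size_cycle_type ct_a mu_odd /=; case: (odd n).
Qed.

(** The two evaluations of the same sum share the factor (n - 1)!, which cancels. *)
Lemma Bcount_Acount n mu : 0 < n -> is_partition n.+1 mu ->
    odd (size mu) = odd n ->
  n.+1 * \sum_(1 <= i < n.+1 | i.+1 \in mu)
           (i * mult i (down i.+1 mu) * Bcount n (down i.+1 mu)) =
  2 * Acount n.+1 mu.
Proof.
move=> n0 mu_part mu_odd; have := sum_nfact_cycle_type n0 mu_part mu_odd.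
rewrite sum_nfact_ord0 // => E; apply/eqP.
rewrite -(eqn_pmul2l (fact_gt0 n.-1)) mulnCA E mulnCA [X in _ == X]mulnCA.
by rewrite (mulnC (Acount _ _)).
Qed.

End Recursions.

Local Open Scope ring_scope.

Theorem theorem1p2 (N : nat) (mu : seq nat) :
  (1 <= N)%N -> is_partition N.+1 mu -> odd (size mu) = odd N ->
  ((N.+1)%:R / 2%:R : rat) *
    (\sum_(1 <= i < N.+1 | i.+1 \in mu)
        (i * mult i (down i.+1 mu) * Bcount N (down i.+1 mu))%N)%:R
    = (Acount N.+1 mu)%:R
  /\ (Acount N.+1 mu)%:R = ((N.+1)`!)%:R / (zee mu)%:R :> rat.
Proof.
move=> N0 mu_part mu_odd; have AZ := Acount_zee mu_part; split.
  rewrite mulrAC -natrM Bcount_Acount // natrM mulrC mulKf //.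
have Z0 : (zee mu)%:R != 0 :> rat.
  by rewrite pnatr_eq0; apply: contraTneq (fact_gt0 N.+1) => Z0;
    rewrite -AZ Z0 muln0.
by rewrite -AZ natrM mulfK.
Qed.
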